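(* Let $n\ge3$. A symmetric positive definite matrix $A\in\mathcal{S}^n_+$ belongs to the class $\mathcal{A}_2$ if and only if the vector $\mu=\lambda(A^2)\in\mathbb{R}^n$ of eigenvalues of $A^2$ satisfies $$\sigma_2(\mu)-\frac{n-2}{2(n-1)}\,\sigma_1(\mu)^2=1,$$ or equivalently, $$\frac1{n-1}\,\sigma_1(\mu)^2-|\mu|^2=2.$$
   Context: $\mathcal{S}^n_+$ is the set of symmetric positive definite real $n\times n$ matrices; eigenvalues are counted with multiplicity. For $\zeta\in\mathbb{R}^n$, $\sigma_1(\zeta)=\sum_i\zeta_i$, $\sigma_2(\zeta)=\sum_{i<j}\zeta_i\zeta_j$, and $\Gamma_2=\{\zeta\in\mathbb{R}^n:\sigma_1(\zeta)>0,\ \sigma_2(\zeta)>0\}$. The class $\mathcal{A}_2$ is $$\mathcal{A}_2=\Big\{A\in\mathcal{S}^n_+:\ \lambda_i(A)^2=\sum_{j\ne i}\zeta_j\ (i=1,\dots,n)\ \text{for some }\zeta\in\Gamma_2\text{ with }\sigma_2(\zeta)=1\Big\},$$ where $\lambda_1(A),\dots,\lambda_n(A)$ are the eigenvalues of $A$, so $\mu_i=\lambda_i(A)^2$. *)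

(* Defs.v *)
From HB Require Import structures.
From mathcomp Require Import all_boot all_order all_algebra.
From mathcomp Require Import sesquilinear reals polyrcf.

Set Implicit Arguments.
Unset Strict Implicit.
Unset Printing Implicit Defensive.

Import Order.TTheory GRing.Theory Num.Theory.
Local Open Scope ring_scope.

Definition posdefmx (R : realType) (n : nat) (A : 'M[R]_n) : Prop :=
  A \is symmetricmx /\
  forall x : 'cV[R]_n, x != 0 -> 0 < (x^T *m A *m x) 0 0.

(* Real eigenvalues in nondecreasing order (rootsR is sorted), each repeated
   according to its multiplicity as a root of the characteristic polynomial. *)
Definition eigenvalues (R : realType) (n : nat) (A : 'M[R]_n) : seq R :=
  flatten [seq nseq (mup x (char_poly A)) x | x <- rootsR (char_poly A)].

(* The vector lambda(A). A symmetric real matrix has exactly n eigenvalues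
   counted with multiplicity, so the default value 0 of nth is then not used. *)
Definition eigval_vec (R : realType) (n : nat) (A : 'M[R]_n) : 'rV[R]_n :=
  \row_(i < n) (eigenvalues A)`_i.

Definition sigma1 (R : realType) (n : nat) (z : 'rV[R]_n) : R :=
  \sum_(i < n) z 0 i.

Definition sigma2 (R : realType) (n : nat) (z : 'rV[R]_n) : R :=
  \sum_(i < n) \sum_(j < n | (i < j)%N) z 0 i * z 0 j.

(* The squared Euclidean norm; the norm of MathComp-Analysis on matrices is the
   sup norm. *)
Definition sqnorm (R : realType) (n : nat) (z : 'rV[R]_n) : R :=
  \sum_(i < n) z 0 i ^+ 2.

Definition Gamma2 (R : realType) (n : nat) (z : 'rV[R]_n) : Prop :=
  0 < sigma1 z /\ 0 < sigma2 z.

Definition classA2 (R : realType) (n : nat) (A : 'M[R]_n) : Prop :=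
  posdefmx A /\
  exists zeta : 'rV[R]_n,
    [/\ Gamma2 zeta, sigma2 zeta = 1 &
        forall i : 'I_n,
          eigval_vec A 0 i ^+ 2 = \sum_(j < n | j != i) zeta 0 j].

(* Main.v *)
Require Import Defs.
From HB Require Import structures.
From mathcomp Require Import all_boot all_order all_algebra.
From mathcomp Require Import sesquilinear reals polyrcf.
From mathcomp Require Import spectral complex ring lra.

Set Implicit Arguments.
Unset Strict Implicit.
Unset Printing Implicit Defensive.

Import Order.TTheory GRing.Theory Num.Theory.
Local Open Scope ring_scope.

(** The relation mu_i = sum_(j != i) zeta_j says mu_i = S - zeta_i with
S = sigma1 zeta.  Summing over i gives sigma1 mu = (n - 1) S, so this linear
system is invertible, with zeta_i = sigma1 mu / (n - 1) - mu_i.  Substituting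
into the squared norm gives, for every zeta,

  sigma1 mu ^ 2 / (n - 1) - |mu|^2 = S ^ 2 - |zeta|^2 = 2 sigma2 zeta

([deleted_sum_sqnorm]), so the condition sigma2 zeta = 1 is exactly the second
displayed equation.  When mu has positive entries, S > 0 holds as well, and the
unique candidate zeta is in Gamma2.  The two displayed equations differ by a
factor 2, by the identity 2 sigma2 = sigma1 ^ 2 - |.|^2 ([sigma2_sqnorm]).

What remains is that the entries of [eigval_vec (A ^+ 2)] are, index by index,
the squares of those of [eigval_vec A] ([eigval_vec_posdef]).  The spectral
theorem for the complexification of A shows that the characteristic polynomials
of A and of A ^ 2 split over the reals, with roots d_i and d_i ^ 2.  The vectors
of eigenvalues are the sorted lists of these roots ([eigenvalues_sort]), and
sorting commutes with squaring because positive definiteness makes every d_i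
positive. *)

Lemma char_poly_conj (F : fieldType) (n : nat) (P B : 'M[F]_n) :
  P \in unitmx -> char_poly (invmx P *m B *m P) = char_poly B.
Proof.
move=> Pu; rewrite /char_poly /char_poly_mx !map_mxM /=.
set Q := map_mx polyC (invmx P); set P' := map_mx polyC P.
have QP : Q *m P' = 1%:M by rewrite -map_mxM mulVmx // map_mx1.
have -> : 'X%:M - Q *m map_mx polyC B *m P' =
          Q *m ('X%:M - map_mx polyC B) *m P'.
  by rewrite mulmxBr mulmxBl [Q *m _%:M]scalar_mxC -[_%:M *m Q *m P']mulmxA QP mulmx1.
by rewrite !det_mulmx mulrAC -det_mulmx QP det1 mul1r.
Qed.

Lemma char_poly_diag (F : comNzRingType) (n : nat) (d : 'rV[F]_n) :
  char_poly (diag_mx d) = \prod_(i < n) ('X - (d 0 i)%:P).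
Proof.
rewrite char_poly_trig ?diag_mx_is_trig //.
by apply: eq_bigr => i _; rewrite mxE eqxx mulr1n.
Qed.

(** Both factorizations use the same [d], which pairs each eigenvalue of [A] with
its square.  A diagonalization of [A] over R[i] supplies it: the eigenvalues of a
Hermitian matrix are real, and an identity between characteristic polynomials
of real matrices descends from R[i] to R. *)
Lemma symmetric_char_poly_split (R : rcfType) (n : nat) (A : 'M[R]_n) :
  A \is symmetricmx ->
  exists d : 'rV[R]_n,
    char_poly A = \prod_(i < n) ('X - (d 0 i)%:P) /\
    char_poly (A ^+ 2) = \prod_(i < n) ('X - (d 0 i ^+ 2)%:P).
Proof.
move=> Asym; pose C : 'M[R[i]]_n := map_mx (real_complex R) A.
have Cherm : C \is hermsymmx.
  apply/is_hermitianmxP; rewrite expr0 scale1r.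
  have /is_hermitianmxP := Asym; rewrite expr0 scale1r => AT.
  apply/matrixP => i j; rewrite !mxE [A in LHS]AT !mxE /=.
  by apply/esym/CrealP; rewrite complex_real.
have /orthomx_spectralP := hermitian_normalmx Cherm.
have := hermitian_spectral_diag_real Cherm.
have := spectral_unit C.
move: (spectralmx C) (spectral_diag C) => P D Pu Dreal CE.
pose d : 'rV[R]_n := map_mx (@complex.Re R) D.
have DE : D = map_mx (real_complex R) d.
  by apply/rowP => i; rewrite !mxE RRe_real //; apply: (mxOverP Dreal).
have descend (B : 'M[R]_n) (b : 'rV[R]_n) :
    map_mx (real_complex R) B
      = invmx P *m map_mx (real_complex R) (diag_mx b) *m P ->
    char_poly B = \prod_(i < n) ('X - (b 0 i)%:P).
  move=> BE; apply: (map_poly_inj (real_complex R)).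
  by rewrite -char_poly_diag !map_char_poly BE char_poly_conj.
exists d; split; first by apply: descend; rewrite map_diag_mx -DE.
have -> : \prod_(i < n) ('X - (d 0 i ^+ 2)%:P) =
  \prod_(i < n) ('X - ((\row_j (d 0 j ^+ 2)) 0 i)%:P).
  by apply: eq_bigr => i _; rewrite mxE.
apply: descend.
have -> : diag_mx (\row_j (d 0 j ^+ 2)) = diag_mx d *m diag_mx d.
  by rewrite mulmx_diag; congr diag_mx; apply/rowP => i; rewrite !mxE expr2.
rewrite expr2 -mulmxE !map_mxM map_diag_mx -DE -/C CE.
by rewrite !mulmxA mulmxK.
Qed.

(** If v is a row eigenvector for [a], then v A v^T = a * |v|^2; the left side is
positive and |v|^2 is nonnegative. *)
Lemma posdef_root_gt0 (R : realType) (n : nat) (A : 'M[R]_n) (a : R) :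
  posdefmx A -> root (char_poly A) a -> 0 < a.
Proof.
move=> [_ Apos]; rewrite -eigenvalue_root_char => /eigenvalueP [v vA v0].
have := Apos v^T; rewrite trmx_eq0 => /(_ v0).
rewrite trmxK vA -scalemxAl mxE => av.
have vv : 0 <= (v *m v^T) 0 0.
  by rewrite mxE sumr_ge0 // => i _; rewrite mxE -expr2 sqr_ge0.
by rewrite ltNge; apply: contraL av => a0; rewrite -leNgt mulr_le0_ge0.
Qed.

Lemma sorted_flatten_nseq (disp : Order.disp_t) (T : porderType disp)
    (f : T -> nat) (s : seq T) :
  sorted <=%O s -> sorted <=%O (flatten [seq nseq (f x) x | x <- s]).
Proof.
rewrite !(sorted_pairwise le_trans); elim: s => //= x s IHs /andP[/allP xs ss].
rewrite pairwise_cat IHs // andbT; apply/andP; split.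
  apply/allrelP => y z /nseqP [-> _] /flatten_mapP [w /xs xw /nseqP [-> _]].
  exact: xw.
by elim: (f x) => //= k ->; rewrite andbT; apply/allP => y /nseqP [-> _].
Qed.

(** Both lists are sorted, so it is enough to compare the number of occurrences
of each x, which is the multiplicity of x as a root on both sides. *)
Lemma eigenvalues_sort (R : realType) (n : nat) (A : 'M[R]_n) (s : seq R) :
  char_poly A = \prod_(x <- s) ('X - x%:P) ->
  eigenvalues A = sort <=%R s.
Proof.
move=> AE; have p0 : char_poly A != 0 by rewrite monic_neq0 ?char_poly_monic.
have ltr : sorted <%R (rootsR (char_poly A)) by apply: sorted_roots.
apply: le_sorted_eq.
- by apply: sorted_flatten_nseq; move: ltr; rewrite lt_sorted_uniq_le => /andP[].
- exact: sort_le_sorted.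
rewrite perm_sym perm_sort /eigenvalues; apply/allP => x _ /=; apply/eqP.
rewrite -mu_prod_XsubC -AE count_flatten -map_comp.
set r := rootsR _ in ltr *.
rewrite (eq_map (g := fun y => if y == x then mup x (char_poly A) else 0%N));
  last first.
  (* Only the block of copies of x itself contributes occurrences of x. *)
  by move=> y /=; rewrite count_nseq /=; case: eqP => [->|_]; rewrite ?mul1n.
rewrite sumnE big_map -big_mkcond /= big_const_seq iter_addn addn0.
rewrite (count_uniq_mem _ (lt_sorted_uniq ltr)) /r.
rewrite -(roots_on_rootsR p0) in_itv /=.
by case: (boolP (root _ _)) => [_|/mupNroot ->]; rewrite ?muln1.
Qed.

(** Positivity is what makes squaring increasing on the spectrum, so that the
i-th smallest eigenvalue of [A ^+ 2] is the square of the i-th smallest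
eigenvalue of [A]. *)
Lemma eigval_vec_posdef (R : realType) (n : nat) (A : 'M[R]_n) (i : 'I_n) :
  posdefmx A ->
  0 < eigval_vec A 0 i /\
  eigval_vec (A ^+ 2) 0 i = eigval_vec A 0 i ^+ 2.
Proof.
move=> Apos; have [d [AE A2E]] := symmetric_char_poly_split Apos.1.
pose s := [seq d 0 j | j <- enum 'I_n].
have sE (f : R -> R) : \prod_(j < n) ('X - (f (d 0 j))%:P) =
    \prod_(x <- map f s) ('X - x%:P).
  by rewrite 2!big_map big_enum.
have s0 x : x \in s -> 0 < x.
  move=> xs; apply: (posdef_root_gt0 Apos); rewrite AE (sE id) map_id.
  by rewrite root_prod_XsubC.
have EA : eigenvalues A = sort <=%R s.
  by apply: eigenvalues_sort; rewrite AE (sE id) map_id.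
have EA2 : eigenvalues (A ^+ 2) = [seq x ^+ 2 | x <- sort <=%R s].
  rewrite (eigenvalues_sort (s := map (fun x => x ^+ 2) s)); last first.
    by rewrite A2E (sE (fun x => x ^+ 2)).
  apply: le_sorted_eq; first exact: sort_le_sorted.
  - apply: (homo_sorted_in (P := mem s)) (sort_le_sorted s).
      by move=> x y xs ys xy; rewrite lerXn2r // nnegrE ltW ?s0.
    by apply/allP => x; rewrite mem_sort.
  by rewrite perm_sort perm_map // perm_sym perm_sort.
have szi : (i < size (sort <=%R s))%N.
  by rewrite size_sort size_map size_enum_ord.
rewrite !mxE EA EA2 (nth_map 0) //; split=> //.
by apply: s0; rewrite -(mem_sort <=%R) mem_nth.
Qed.

Lemma sigma2_sqnorm (R : realType) (n : nat) (z : 'rV[R]_n) :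
  2 * sigma2 z = sigma1 z ^+ 2 - sqnorm z.
Proof.
rewrite /sigma1 expr2 big_distrlr /=.
rewrite (eq_bigr (fun i : 'I_n => \sum_(j < n | (i < j)%N) z 0 i * z 0 j +
  (z 0 i ^+ 2 + \sum_(j < n | (j < i)%N) z 0 j * z 0 i))); last first.
  (* Row i of the double sum splits into j > i, j = i and j < i. *)
  move=> i _; rewrite (bigID (fun j : 'I_n => (i < j)%N)) /=; congr (_ + _).
  rewrite (bigD1 i) ?ltnn //= expr2; congr (_ + _).
  apply: eq_big => [j|j _]; last by rewrite mulrC.
  by rewrite -leqNgt [RHS]ltn_neqAle andbC.
rewrite !big_split /= -/(sigma2 z) -/(sqnorm z).
rewrite [X in _ + (_ + X)](exchange_big_dep xpredT) //= -/(sigma2 z).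
ring.
Qed.

(** Here m_i = S - z_i with S = sigma1 z, so that sigma1 m = (n - 1) S and
|m|^2 = (n - 2) S ^ 2 + |z|^2; the left side is therefore S ^ 2 - |z|^2. *)
Lemma deleted_sum_sqnorm (R : realType) (n : nat) (z m : 'rV[R]_n) :
  n%:R != 1 :> R -> (forall i, m 0 i = \sum_(j < n | j != i) z 0 j) ->
  1 / (n%:R - 1) * sigma1 m ^+ 2 - sqnorm m = 2 * sigma2 z.
Proof.
move=> n1 mE.
have {}mE i : m 0 i = sigma1 z - z 0 i.
  by rewrite mE /sigma1 [in RHS](bigD1 i) //= [RHS]addrC addKr.
have m1 : sigma1 m = (n%:R - 1) * sigma1 z.
  rewrite {1}/sigma1 (eq_bigr _ (fun i _ => mE i)) sumrB sumr_const card_ord.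
  by rewrite -/(sigma1 z) -mulr_natl; ring.
have m2 : sqnorm m = n%:R * sigma1 z ^+ 2 - 2 * sigma1 z ^+ 2 + sqnorm z.
  rewrite /sqnorm.
  rewrite (eq_bigr (fun i => sigma1 z ^+ 2 - 2 * sigma1 z * z 0 i + z 0 i ^+ 2)).
    rewrite big_split sumrB sumr_const card_ord -mulr_sumr /= -/(sigma1 z).
    by rewrite -mulr_natl; ring.
  by move=> i _; rewrite mE; ring.
rewrite sigma2_sqnorm m1 m2; field.
by rewrite subr_eq0.
Qed.

Theorem lemma3p1 (R : realType) (n : nat) (hn : (3 <= n)%N)
  (A : 'M[R]_n) (hA : posdefmx A) :
  let mu : 'rV[R]_n := eigval_vec (A ^+ 2) in
  (classA2 A <->
     sigma2 mu - (n%:R - 2) / (2 * (n%:R - 1)) * sigma1 mu ^+ 2 = 1) /\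
  (sigma2 mu - (n%:R - 2) / (2 * (n%:R - 1)) * sigma1 mu ^+ 2 = 1 <->
     1 / (n%:R - 1) * sigma1 mu ^+ 2 - sqnorm mu = 2).
Proof.
move=> mu.
have n1 : 1 < n%:R :> R by rewrite ltr1n (leq_trans _ hn).
have n1' : n%:R != 1 :> R by rewrite gt_eqF.
have n10 : n%:R - 1 != 0 :> R by rewrite subr_eq0.
have mu_sq i : mu 0 i = eigval_vec A 0 i ^+ 2 by case: (eigval_vec_posdef i hA).
have doubled : 1 / (n%:R - 1) * sigma1 mu ^+ 2 - sqnorm mu =
    2 * (sigma2 mu - (n%:R - 2) / (2 * (n%:R - 1)) * sigma1 mu ^+ 2).
  by rewrite mulrBr sigma2_sqnorm; field.
suff H : classA2 A <-> 1 / (n%:R - 1) * sigma1 mu ^+ 2 - sqnorm mu = 2.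
  have H2 : sigma2 mu - (n%:R - 2) / (2 * (n%:R - 1)) * sigma1 mu ^+ 2 = 1 <->
     1 / (n%:R - 1) * sigma1 mu ^+ 2 - sqnorm mu = 2.
    by rewrite doubled; split=> h; lra.
  by split=> //; split=> [/H /H2|/H2 /H].
split=> [[_ [z [_ z1 zE]]]|h].
  rewrite (@deleted_sum_sqnorm _ _ z) // ?z1 ?mulr1 // => i.
  by rewrite mu_sq zE.
(* Summing mu_i = sigma1 zeta - zeta_i over i determines sigma1 zeta, and hence
   the only possible zeta. *)
pose z : 'rV[R]_n := \row_i (sigma1 mu / (n%:R - 1) - mu 0 i).
have z1 : sigma1 z = sigma1 mu / (n%:R - 1).
  rewrite {1}/sigma1 (eq_bigr (fun i => sigma1 mu / (n%:R - 1) - mu 0 i)).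
    rewrite sumrB sumr_const card_ord -/(sigma1 mu) -mulr_natl; field.
    exact: n10.
  by move=> i _; rewrite mxE.
have zE i : mu 0 i = \sum_(j < n | j != i) z 0 j.
  have := z1; rewrite {1}/sigma1 (bigD1 i) //= mxE => e.
  by apply: (addrI (sigma1 mu / (n%:R - 1) - mu 0 i)); rewrite e subrK.
have z2 : sigma2 z = 1 by have := deleted_sum_sqnorm n1' zE; rewrite h; lra.
split=> //; exists z; split=> // [|i]; last by rewrite -mu_sq zE.
split; last by rewrite z2.
have mu_gt0 i : 0 < mu 0 i.
  by rewrite mu_sq exprn_gt0 //; case: (eigval_vec_posdef i hA).
rewrite z1 divr_gt0 ?subr_gt0 // /sigma1.
rewrite (bigD1 (Ordinal (leq_trans (isT : 0 < 3)%N hn))) //=.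
by rewrite ltr_pwDl // sumr_ge0 // => i _; rewrite ltW.
Qed.
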